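(* Let $G=\{g_1,\dots,g_N\}$ be a finite group with $N=|G|$ elements, let $\kappa>0$ and $V\in\mathbb U(d)$, and consider the Lohe matrix model with frustration matrix $V$, $$\dot U_jU_j^*=\frac{\kappa}{2N}\sum_{k=1}^N\big(VU_kU_j^*-U_jU_k^*V^*\big),\qquad j=1,\dots,N.\qquad(\ast)$$ (1) If $\varrho:G\to\mathbb U(d)$ is a group homomorphism, then the initial condition $U_i^0=\varrho(g_i)$, $i=1,\dots,N$, is an equilibrium state for $(\ast)$ with $V=I_d$. (2) If $\varrho:G\to\mathbb U(d)$ is an irreducible unitary representation of $G$, then the initial condition $U_i^0=\varrho(g_i)$, $i=1,\dots,N$, is an equilibrium state for $(\ast)$.
   Context: $\mathbb U(d)$ is the group of $d\times d$ unitary matrices, $I_d$ is the identity matrix and $^*$ denotes the Hermitian conjugate. An equilibrium state is a configuration $(U_1^0,\dots,U_N^0)\in\mathbb U(d)^N$ at which the right-hand side of the system vanishes for every $j$.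
   Formalization: In (2) it is additionally assumed that ϱ is not the trivial representation or that V*=V; otherwise the claim is false (d=1, ϱ≡1, V=i gives right-hand side κi≠0). *)

(* Defs.v *)
From mathcomp Require Import all_boot all_order all_algebra all_fingroup.
From mathcomp Require Import mxrepresentation reals.
From mathcomp Require Import complex.

Set Implicit Arguments.
Unset Strict Implicit.
Unset Printing Implicit Defensive.

Import Order.TTheory GRing.Theory Num.Theory.
Local Open Scope ring_scope.
Local Open Scope complex_scope.
Local Open Scope sesquilinear_scope.

(* The system is written in the form U_j' U_j^* = lohe_rhs kappa V U j;
   [A ^t*] is the Hermitian conjugate of [A]. *)
Definition lohe_rhs (R : realType) (d N : nat) (kappa : R) (V : 'M[R[i]]_d)
    (U : 'I_N -> 'M[R[i]]_d) (j : 'I_N) : 'M[R[i]]_d :=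
  (kappa / (2 * N%:R))%:C *:
    \sum_(k < N) (V *m U k *m (U j)^t* - U j *m (U k)^t* *m V^t*).

Definition lohe_equilibrium (R : realType) (d N : nat) (kappa : R)
    (V : 'M[R[i]]_d) (U : 'I_N -> 'M[R[i]]_d) : Prop :=
  (forall j, U j \is unitarymx) /\ (forall j, lohe_rhs kappa V U j = 0).

(* Main.v *)
(* With S the sum of all rho x, right translation gives S rho(x)^* = S, and
   S is Hermitian and fixed by every rho x.  The right-hand side of the system
   is therefore a multiple of V S - S V^*, the same for every j.  This vanishes
   for V = 1.  If rho is irreducible and S <> 0, then the row space of S is a
   nonzero submodule, so S is invertible and S rho(x) = S makes rho trivial and
   S scalar; thus either S = 0, or V S - S V^* is a multiple of V - V^*. *)

Require Import Defs.
From mathcomp Require Import all_boot all_order all_algebra all_fingroup.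
From mathcomp Require Import mxrepresentation reals.
From mathcomp Require Import complex.

Import Order.TTheory GRing.Theory Num.Theory.
Local Open Scope ring_scope.
Local Open Scope complex_scope.
Local Open Scope sesquilinear_scope.

Set Implicit Arguments.
Unset Strict Implicit.
Unset Printing Implicit Defensive.

Lemma unitarymx_mul_id (C : numClosedFieldType) (d : nat) (A : 'M[C]_d) :
  A \is unitarymx -> A *m A = A -> A = 1%:M.
Proof.
move=> Au AA; have /unitarymxP AAt := Au.
by rewrite -[A]mulmx1 -AAt mulmxA AA.
Qed.

Lemma unitarymx_mul1 (C : numClosedFieldType) (d : nat) (A B : 'M[C]_d) :
  A \is unitarymx -> B *m A = 1%:M -> A^t* = B.
Proof.
by move=> /unitarymxP AAt BA; rewrite -[LHS]mul1mx -BA -mulmxA AAt mulmx1.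
Qed.

Section GroupSum.

Variables (R : pzSemiRingType) (gT : finGroupType) (G : {group gT}).
Variables (d : nat) (rho : gT -> 'M[R]_d).
Hypothesis rhoM :
  forall x y, x \in G -> y \in G -> rho (x * y)%g = rho x *m rho y.

Lemma group_sum_mulr x :
  x \in G -> (\sum_(y in G) rho y) *m rho x = \sum_(y in G) rho y.
Proof.
move=> Gx; rewrite mulmx_suml [RHS](reindex_inj (mulIg x)) /=.
by apply: eq_big => y; [rewrite groupMr | move=> Gy; rewrite rhoM].
Qed.

Lemma group_sum_mull x :
  x \in G -> rho x *m (\sum_(y in G) rho y) = \sum_(y in G) rho y.
Proof.
move=> Gx; rewrite mulmx_sumr [RHS](reindex_inj (mulgI x)) /=.
by apply: eq_big => y; [rewrite groupMl | move=> Gy; rewrite rhoM].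
Qed.

End GroupSum.

Section UnitaryMorphism.

Variables (C : numClosedFieldType) (gT : finGroupType) (G : {group gT}).
Variables (d : nat) (rho : gT -> 'M[C]_d).
Hypothesis rhoU : forall x, x \in G -> rho x \is unitarymx.
Hypothesis rhoM :
  forall x y, x \in G -> y \in G -> rho (x * y)%g = rho x *m rho y.

(** Multiplicativity only makes [rho 1] idempotent; unitarity allows one factor to be cancelled. *)
Lemma unitary_morph1 : rho 1%g = 1%:M.
Proof. by apply: unitarymx_mul_id; rewrite ?rhoU // -rhoM // mulg1. Qed.

Lemma unitary_morphV x : x \in G -> (rho x)^t* = rho x^-1%g.
Proof.
move=> Gx; apply: unitarymx_mul1; first exact: rhoU.
by rewrite -rhoM ?groupV // mulVg unitary_morph1.
Qed.

(** Conjugate transposition sends [rho x] to [rho x^-1], and inversion permutes [G]. *)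
Lemma group_sum_trC : (\sum_(x in G) rho x)^t* = \sum_(x in G) rho x.
Proof.
rewrite raddf_sum raddf_sum [RHS](reindex_inj invg_inj) /=.
by apply: eq_big => y; [rewrite groupV | move=> Gy; exact: unitary_morphV].
Qed.

End UnitaryMorphism.

Lemma irr_group_sum (F : fieldType) (gT : finGroupType) (G : {group gT})
    (d : nat) (rG : mx_representation F G d) :
  mx_irreducible rG ->
  \sum_(x in G) rG x = 0 \/ (forall x, x \in G -> rG x = 1%:M).
Proof.
move=> /mx_irrP [_ irrG]; set S := \sum_(x in G) rG x.
have Sr : forall x, x \in G -> S *m rG x = S :=
  group_sum_mulr (repr_mxM rG).
have [-> | nzS] := eqVneq S 0; [by left | right=> x Gx].
have modS : mxmodule rG S by apply/mxmoduleP => y Gy; rewrite Sr.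
(* By irreducibility the nonzero submodule spanned by the rows of [S] is the whole space; then [S]
   can be cancelled from [S *m rG x = S]. *)
have uS : S \in unitmx by rewrite -row_full_unit irrG.
by rewrite -[LHS](mulKmx uS) Sr // mulVmx.
Qed.

(** The image of [g] has as many elements as its domain, so [g] is injective and enumerates [G]
    without repetition. *)
Lemma sum_enum_group (V : nmodType) (gT : finGroupType) (G : {group gT})
    (N : nat) (g : 'I_N -> gT) (F : gT -> V) :
  N = #|G| -> [set g i | i : 'I_N] = G :> {set gT} ->
  \sum_i F (g i) = \sum_(x in G) F x.
Proof.
move=> hN hg; have /imset_injP g_inj : #|[set g i | i : 'I_N]| == #|'I_N|.
  by rewrite hg -hN card_ord.
by rewrite -hg big_imset.
Qed.

Lemma lohe_rhs_group_sum (R : realType) (gT : finGroupType) (G : {group gT})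
    (N : nat) (g : 'I_N -> gT) (d : nat) (kappa : R) (V : 'M[R[i]]_d)
    (rho : gT -> 'M[R[i]]_d) (j : 'I_N) :
  N = #|G| -> [set g i | i : 'I_N] = G :> {set gT} ->
  (forall x, x \in G -> rho x \is unitarymx) ->
  (forall x y, x \in G -> y \in G -> rho (x * y)%g = rho x *m rho y) ->
  let S := \sum_(x in G) rho x in
  lohe_rhs kappa V (fun i => rho (g i)) j
    = (kappa / (2 * N%:R))%:C *: (V *m S - S *m V^t*).
Proof.
move=> hN hg rhoU rhoM S; rewrite /lohe_rhs; congr (_ *: _).
have Gj : g j \in G by rewrite -hg imset_f.
have SE : \sum_i rho (g i) = S := sum_enum_group rho hN hg.
have StE : \sum_i (rho (g i))^t* = S.
  by rewrite -[RHS](group_sum_trC rhoU rhoM) -/S -SE raddf_sum raddf_sum.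
(* Factoring out what does not depend on [k] leaves [V S U_j^* - U_j S V^*]. Here [U_j^*] is [rho]
   at the inverse of [g j], so [S] absorbs both [U_j] and [U_j^*]. *)
rewrite sumrB -!mulmx_suml -!mulmx_sumr SE StE.
rewrite (group_sum_mull rhoM) // -mulmxA (unitary_morphV rhoU rhoM) //.
by rewrite (group_sum_mulr rhoM) // groupV.
Qed.

Theorem theorem5p2 (R : realType) (gT : finGroupType) (G : {group gT})
    (N : nat) (hN : N = #|G|)
    (g : 'I_N -> gT) (hg : [set g i | i : 'I_N] = G :> {set gT})
    (d : nat) (kappa : R) (hkappa : 0 < kappa)
    (V : 'M[R[i]]_d) (hV : V \is unitarymx) :
  (* (1) *)
  (forall rho : gT -> 'M[R[i]]_d,
     (forall x, x \in G -> rho x \is unitarymx) ->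
     (forall x y, x \in G -> y \in G -> rho (x * y)%g = rho x *m rho y) ->
     lohe_equilibrium kappa 1%:M (fun i => rho (g i)))
  /\
  (* (2); for the trivial representation and V^* <> V the right-hand side of
     the system does not vanish, so exactly this case is excluded *)
  (forall rho : mx_representation R[i] G d,
     (forall x, x \in G -> rho x \is unitarymx) ->
     mx_irreducible rho ->
     (exists2 x, x \in G & rho x != 1%:M) \/ V^t* = V ->
     lohe_equilibrium kappa V (fun i => rho (g i))).
Proof.
have Gg j : g j \in G by rewrite -hg imset_f.
split=> [rho rhoU rhoM | rho rhoU irr_rho nontriv].
  split=> j; first exact/rhoU/Gg.
  by rewrite (lohe_rhs_group_sum _ _ _ hN hg) // trmx1 map_mx1 mul1mx mulmx1
             subrr scaler0.
split=> j; first exact/rhoU/Gg.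
rewrite (lohe_rhs_group_sum _ _ _ hN hg) //; last exact: repr_mxM.
have [-> | triv] := irr_group_sum irr_rho.
  by rewrite mulmx0 mul0mx subrr scaler0.
(* A nontrivial [rho x] contradicts [triv], which leaves the case of a Hermitian [V]; there [S] is
   the scalar matrix of [#|G|] and commutes with [V]. *)
case: nontriv => [[x Gx] | ->]; first by rewrite triv // eqxx.
rewrite (eq_bigr (fun=> 1%:M)) // sumr_const -scaler_nat.
by rewrite scalemx1 scalar_mxC subrr scaler0.
Qed.
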